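(* Let $k\ge 1$. There exists a one-to-one correspondence between equivalence classes of irreducible (complex) representations of the iterated wreath product $W(\vec r|_k)$ of cyclic groups and orbits, under the action of $W(\vec r|_k)$, of compatible $\vec r|_k$-labels.
   Context: Fix a sequence of positive integers $\vec r=(r_1,r_2,\ldots)$ and write $\vec r|_k=(r_1,\ldots,r_k)$. For a finite group $G$, the wreath product $G\wr\mathbb{Z}_n$ is $G^n\rtimes\mathbb{Z}_n$, where $\mathbb{Z}_n$ (viewed as generated by an $n$-cycle in $S_n$) cyclically permutes the $n$ coordinates: $(a;\pi)(b;\sigma)=(ab^{\pi};\pi\sigma)$ with $b^{\pi}=(b_{\pi^{-1}(1)},\ldots,b_{\pi^{-1}(n)})$. Define recursively $W(\vec r|_0)$ to be the trivial group and $W(\vec r|_k)=W(\vec r|_{k-1})\wr\mathbb{Z}_{r_k}$, so $W(\vec r|_1)=\mathbb{Z}_{r_1}$. The complete $\vec r|_k$-tree $T(\vec r|_k)$ is defined recursively: $T(\vec r|_1)$ is a single root node; for $k\ge2$, $T(\vec r|_k)$ consists of a root with $r_k$ children, each the root of a copy of $T(\vec r|_{k-1})$. Thus it has $k$ levels of nodes. For a vertex $v$, $T_v$ denotes the subtree rooted at $v$ consisting of $v$ and all its descendants. The group $W(\vec r|_k)$ acts on $T(\vec r|_k)$ by tree automorphisms: $W(\vec r|_1)$ acts trivially on the single node; for $k\ge2$, in $W(\vec r|_k)=W(\vec r|_{k-1})^{r_k}\rtimes\mathbb{Z}_{r_k}$ the $i$-th factor $W(\vec r|_{k-1})$ acts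 on the maximal subtree at the $i$-th child of the root, and $\mathbb{Z}_{r_k}$ cyclically permutes the $r_k$ maximal subtrees. An $\vec r|_k$-label is a function $\phi:V_{T(\vec r|_k)}\to\mathbb{N}$ on the vertices of $T(\vec r|_k)$. The group $W(\vec r|_k)$ acts on labels by $\phi^g(v)=\phi(v^g)$, where $v^g$ is the image of the vertex $v$ under $g$; two labels are equivalent if they are in the same orbit. Write $[n]=\{1,\ldots,n\}$. A label $\phi$ is compatible if: (1) for $k=1$: $\phi(\text{root})\in[r_1]$; (2) for $k>1$: (a) for every child $v$ of the root, the restriction $\phi_v=\phi|_{T_v}$ is a compatible $\vec r|_{k-1}$-label, and (b) $\phi(\text{root})\in[d]$, where $\mathbb{Z}_d$ is the stabilizer (so $d$ is its order), under the cyclic rotation action of $\mathbb{Z}_{r_k}$, of the tuple $([\phi_{v_1}],\ldots,[\phi_{v_{r_k}}])$ of equivalence classes (i.e. $W(\vec r|_{k-1})$-orbits) of the restrictions of $\phi$ to the maximal subtrees at the children $v_1,\ldots,v_{r_k}$ of the root. *)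

(* Defs.v *)
From HB Require Import structures.
From mathcomp Require Import all_boot all_order all_algebra all_fingroup.
From mathcomp Require Import mxrepresentation.
From mathcomp Require Import boolp classical_sets functions reals.
From mathcomp Require Import complex.

Set Implicit Arguments.
Unset Strict Implicit.
Unset Printing Implicit Defensive.

Definition cycle_perm (n : nat) : 'S_n := perm (@ordS_inj n).

(* Z_n, realized as the subgroup of S_n generated by an n-cycle. *)
Definition rotations (n : nat) : {group 'S_n} := <[cycle_perm n]>%G.

(* b^pi = (b_{pi^-1(1)}, ..., b_{pi^-1(n)}) *)
Definition permute (T : Type) (n : nat) (p : 'S_n) (b : 'I_n -> T) : 'I_n -> T :=
  fun i => b ((p^-1)%g i).

Record wreath (G : finGroupType) (n : nat) : Type := Wreath {
  base : {ffun 'I_n -> G};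
  top : subg_of (rotations n)
}.

Section WreathGroup.
Variables (G : finGroupType) (n : nat).
Local Open Scope group_scope.

Definition pair_of_wreath (g : wreath G n) := (base g, top g).
Definition wreath_of_pair (u : {ffun 'I_n -> G} * subg_of (rotations n)) :=
  Wreath u.1 u.2.

Lemma pair_of_wreathK : cancel pair_of_wreath wreath_of_pair.
Proof. by case. Qed.

HB.instance Definition _ := Finite.copy (wreath G n) (can_type pair_of_wreathK).

(* (a; p)(b; q) = (a b^p; p q).  MathComp composes permutations from left to
   right, which is immaterial here since the rotations commute. *)
Definition wreath_mul (g h : wreath G n) : wreath G n :=
  Wreath [ffun i => base g i * permute (sgval (top g)) (base h) i]
         (top g * top h).

Definition wreath_one : wreath G n := Wreath [ffun => 1] 1.

Definition wreath_inv (g : wreath G n) : wreath G n :=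
  Wreath [ffun i => (base g (sgval (top g) i))^-1] (top g)^-1.

Lemma wreath_eq (g h : wreath G n) :
  base g =1 base h -> top g = top h -> g = h.
Proof. by case: g h => [a p] [b q] /= /ffunP-> ->. Qed.

Lemma wreath_mulA : associative wreath_mul.
Proof.
move=> g h k; apply: wreath_eq => [i|] /=; last exact: mulgA.
rewrite !ffunE /permute !ffunE mulgA; congr (_ * base k _).
rewrite /= -permM -invMg.
have /centsP cent := cycle_abelian (cycle_perm n).
congr (fun_of_perm _^-1 i); apply: cent; exact: subgP.
Qed.

Lemma wreath_mul1 : left_id wreath_one wreath_mul.
Proof.
move=> g; apply: wreath_eq => [i|] /=; last exact: mul1g.
by rewrite !ffunE /permute invg1 perm1 mul1g.
Qed.

Lemma wreath_mulV : left_inverse wreath_one wreath_inv wreath_mul.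
Proof.
move=> g; apply: wreath_eq => [i|] /=; last exact: mulVg.
by rewrite !ffunE /permute /= invgK mulVg.
Qed.

HB.instance Definition _ := Finite_isGroup.Build (wreath G n)
  wreath_mulA wreath_mul1 wreath_mulV.

End WreathGroup.

(* The sequence (r_1, r_2, ...) is [r 1, r 2, ...]; the value [r 0] is not used.
   'I_1 is the trivial group. *)
Fixpoint W (r : nat -> nat) (k : nat) : finGroupType :=
  match k with
  | 0 => 'I_1
  | k'.+1 => wreath (W r k') (r k'.+1)
  end.

(* The vertices of T(r|_k): for k >= 2, [None] is the root and [Some (i, x)] is
   the vertex x of the subtree at the i-th child of the root. *)
Fixpoint vertex (r : nat -> nat) (k : nat) : Type :=
  match k with
  | 0 => void
  | (k''.+1 as k').+1 => option ('I_(r k'.+1) * vertex r k')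
  | _.+1 => unit
  end.

(* The action on vertices is a left action, which matches the product (a; p)(b; q)
   above: (a; p) = (a; 1)(1; p) first moves the i-th subtree to the p(i)-th
   position and then lets a_{p(i)} act there. *)
Fixpoint vact (r : nat -> nat) (k : nat) : W r k -> vertex r k -> vertex r k :=
  match k return W r k -> vertex r k -> vertex r k with
  | 0 => fun _ v => v
  | k'.+1 =>
    match k' return (W r k' -> vertex r k' -> vertex r k') ->
                    W r k'.+1 -> vertex r k'.+1 -> vertex r k'.+1 with
    | 0 => fun _ _ v => v
    | _.+1 => fun act g v =>
      match v with
      | None => None
      | Some (i, x) =>
        let j := sgval (top g) i in Some (j, act (base g j) x)
      end
    end (@vact r k')
  end.

Definition label (r : nat -> nat) (k : nat) : Type := vertex r k -> nat.

Definition lact (r : nat -> nat) (k : nat) (phi : label r k) (g : W r k) :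
  label r k := fun v => phi (vact g v).

Definition label_orbit (r : nat -> nat) (k : nat) (phi : label r k) :
  set (label r k) := [set psi | exists g, psi = lact phi g]%classic.

Definition restrict (r : nat -> nat) (k : nat) (phi : label r k.+2)
  (i : 'I_(r k.+2)) : label r k.+1 := fun x => phi (Some (i, x)).

Definition rotation_stab (T : Type) (n : nat) (t : 'I_n -> T) : {set 'S_n} :=
  [set p in rotations n | `[< permute p t = t >]]%SET.

Fixpoint compatible (r : nat -> nat) (k : nat) : label r k -> Prop :=
  match k return label r k -> Prop with
  | 0 => fun _ => True
  | k'.+1 =>
    match k' return (label r k' -> Prop) -> label r k'.+1 -> Prop with
    | 0 => fun _ phi => 1 <= phi tt <= r 1
    | _.+1 => fun compat phi =>
      (forall i, compat (restrict phi i)) /\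
      1 <= phi None <= #|rotation_stab (fun i => label_orbit (restrict phi i))|
    end (@compatible r k')
  end.

Definition compatible_orbits (r : nat -> nat) (k : nat) :
  set (set (label r k)) :=
  [set label_orbit phi | phi in [set phi | compatible phi]]%classic.

Definition representation (F : fieldType) (G : finGroupType) : Type :=
  {n : nat & mx_representation F [set: G]%G n}.

Definition rep_class (F : fieldType) (G : finGroupType)
  (rho : representation F G) : set (representation F G) :=
  [set rho' | mx_rsim (tagged rho) (tagged rho')]%classic.

Definition irreducible_classes (F : fieldType) (G : finGroupType) :
  set (set (representation F G)) :=
  [set rep_class rho | rho in [set rho | mx_irreducible (tagged rho)]]%classic.

Arguments compatible_orbits : clear implicits.
Arguments irreducible_classes : clear implicits.

(* Main.v *)
Require Import Defs.
From mathcomp Require Import all_boot all_order all_algebra all_fingroup.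
From mathcomp Require Import cyclic pgroup mxrepresentation.
From mathcomp Require Import boolp classical_sets functions reals.
From mathcomp Require Import complex.

(* Irreducible representations are counted by conjugacy classes, so it suffices
   to match conjugacy classes with orbits of compatible labels.  An element g of
   G wr Z_n with top p has its cycles under p all of the same length m = #[p], and
   its conjugacy class is determined by p together with the tuple of G-classes of
   the coordinates of g ^+ m, up to rotation of the tuple.  The tuples that occur
   with p are exactly those fixed by p.  Hence the classes of G wr Z_n correspond
   to rotation orbits of tuples t of classes of G, with a chosen element p of the
   stabilizer of t.  A compatible label is built in the same way, by recursion: the
   root value, in [1, d] with d the order of the stabilizer, numbers its elements. *)

Set Implicit Arguments.
Unset Strict Implicit.
Unset Printing Implicit Defensive.

(** * The regular action of the cyclic group of rotations *)

Section Rotations.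
Variable n : nat.
Local Open Scope group_scope.
Implicit Types (p q : 'S_n) (i j : 'I_n).

Lemma cycle_permXE s i : (cycle_perm n ^+ s) i = (i + s) %% n :> nat.
Proof.
rewrite permX; elim: s => [|s IHs] /=; first by rewrite addn0 modn_small.
by rewrite permE /= IHs -addn1 modnDml addn1 addnS.
Qed.

Lemma rotations_trans i j : exists2 p, p \in rotations n & p i = j.
Proof.
exists (cycle_perm n ^+ (j + (n - i))); first exact: mem_cycle.
apply: val_inj; rewrite /= cycle_permXE addnCA subnKC ?modnDr ?modn_small //.
exact: ltnW.
Qed.

Lemma rotationsC p q : p \in rotations n -> q \in rotations n -> p * q = q * p.
Proof. by move=> Rp Rq; apply: (centsP (cycle_abelian (cycle_perm n))). Qed.

(** A transitive abelian group acts freely: rotations commuting with [p] carry its fixed point [i]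
    to every other point. *)
Lemma rotations_free p i : p \in rotations n -> p i = i -> p = 1.
Proof.
move=> Rp pi; apply/permP => j; have [q Rq <-] := rotations_trans i j.
by rewrite perm1 -permM -(rotationsC Rp Rq) permM pi.
Qed.

Lemma card_rotations : 0 < n -> #|rotations n| = n.
Proof.
move=> n_gt0; apply/eqP; rewrite eqn_dvd.
have dvd_n s : cycle_perm n ^+ s = 1 -> n %| s.
  move=> cs1; have := cycle_permXE s (Ordinal n_gt0).
  by rewrite cs1 perm1 /= add0n => /esym/eqP.
rewrite [X in _ && X]dvd_n ?expg_order // andbT order_dvdn; apply/eqP/permP => i.
by apply: val_inj; rewrite /= cycle_permXE perm1 modnDr modn_small.
Qed.

(** By freeness every cycle of [p] has length [#[p]], so the point reached from [i] determines the
    number of steps modulo [#[p]]. *)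
Lemma rotationsX_inj p a b i :
  p \in rotations n -> (p ^+ a) i = (p ^+ b) i -> a = b %[mod #[p]].
Proof.
move=> Rp eq_i; apply/eqP; rewrite -eq_expg_mod_order eq_mulgV1; apply/eqP.
apply: (@rotations_free _ i); first by rewrite groupM ?groupV ?groupX.
by rewrite permM eq_i permK.
Qed.

End Rotations.

(** * Conjugacy classes of the wreath product *)

Section WreathClasses.
Variables (G : finGroupType) (n : nat).
Local Open Scope group_scope.
Implicit Types (g h u : wreath G n) (i j : 'I_n) (p q : 'S_n).
Local Notation tp g := (sgval (top g)).

Lemma top_rotation g : tp g \in rotations n. Proof. exact: subgP. Qed.

Lemma top_mul g h : tp (g * h) = tp g * tp h. Proof. by []. Qed.

Lemma top_inv g : tp g^-1 = (tp g)^-1. Proof. by []. Qed.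

Lemma top_exp g m : tp (g ^+ m) = tp g ^+ m.
Proof. by elim: m => // m IHm; rewrite !expgS top_mul IHm. Qed.

Lemma top_conj g h : tp (g ^ h) = tp g.
Proof.
rewrite conjgE !top_mul top_inv (rotationsC (top_rotation g)) ?top_rotation //.
by rewrite mulKg.
Qed.

Lemma base_mul g h i : base (g * h) (tp g i) = base g (tp g i) * base h i.
Proof. by rewrite ffunE /permute permK. Qed.

(* The coordinate of g ^+ #[top g] at i is the product of the base coordinates of
   g along the cycle through i, read from i; the exponent does not depend on i
   because nontrivial rotations have no fixed point. *)
Definition cycle_class g : 'I_n -> {set G} :=
  fun i => base (g ^+ #[tp g]) i ^: [set: G].

Lemma class_conj (x y : G) : (x ^ y) ^: [set: G] = x ^: [set: G].
Proof. by apply/class_eqP; rewrite memJ_class ?inE. Qed.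

Lemma top_exp_order g : tp (g ^+ #[tp g]) = 1.
Proof. by rewrite top_exp expg_order. Qed.

(** With [m = #[tp g]], comparing coordinates in [g * g ^+ m = g ^+ m * g] shows that starting one
    step later conjugates the cycle product. *)
Lemma cycle_class_top g i : cycle_class g (tp g i) = cycle_class g i.
Proof.
have := base_mul g (g ^+ #[tp g]) i; rewrite -expgS expgSr.
have := base_mul (g ^+ #[tp g]) g (tp g i).
rewrite top_exp_order perm1 => -> /(canRL (mulgK _)) eq_g.
by rewrite /cycle_class eq_g -(class_conj _ (base g (tp g i))) conjgE mulgKV mulKg.
Qed.

Lemma cycle_class_conj g h i : cycle_class (g ^ h) i = cycle_class g (tp h i).
Proof.
rewrite /cycle_class top_conj -conjXg; set u := g ^+ _.
have u1 : tp u = 1 by apply: top_exp_order.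
(* Coordinates are compared in [h * u ^ h = u * h], where [u] has trivial top. *)
have := base_mul h (u ^ h) i; rewrite -conjgC.
have := base_mul u h (tp h i); rewrite u1 perm1 => ->.
by move=> /esym/(canRL (mulKg _)) ->; rewrite -conjgE class_conj.
Qed.

(** A base point in each cycle and the number of steps from it serve as coordinates on the indices,
    so that elements can be built cycle by cycle. *)
Definition cycle_root p i : 'I_n := froot p i.
Definition cycle_time p i : nat := findex p (cycle_root p i) i.

Lemma cycle_timeK p i : (p ^+ cycle_time p i) (cycle_root p i) = i.
Proof.
rewrite permX iter_findex // fconnect_sym; last exact: perm_inj.
exact: connect_root.
Qed.

Lemma cycle_root_perm p i : cycle_root p (p i) = cycle_root p i.
Proof.
apply/esym/fingraph.rootP; last exact: fconnect1.
exact/fconnect_sym/perm_inj.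
Qed.

Lemma cycle_class_eq_conj g g' :
  top g = top g' -> cycle_class g =1 cycle_class g' -> exists h, g' = g ^ h.
Proof.
move=> eq_top eq_cyc; set p := tp g.
have /fin_all_exists[b eq_b] i : exists b : G,
    base (g' ^+ #[p]) i * b = b * base (g ^+ #[p]) i.
  have /class_eqP/imsetP[b _ ->] := eq_cyc i.
  by exists b; rewrite /p eq_top -conjgC.
(* The conjugator is fixed at the base point x of a cycle by eq_b; transporting it
   a steps along the cycle forces the value E a x, which is periodic in a since
   b x conjugates the two cycle products at x. *)
pose E a x := base (g' ^+ a) ((p ^+ a) x) * b x * (base (g ^+ a) ((p ^+ a) x))^-1.
have top' m : tp (g' ^+ m) = p ^+ m by rewrite top_exp -eq_top.
have topg m : tp (g ^+ m) = p ^+ m by rewrite top_exp.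
have E_S a x : E a.+1 x = base g' (p ((p ^+ a) x)) * E a x *
                         (base g (p ((p ^+ a) x)))^-1.
  rewrite /E (expgSr p) permM (expgS g) (expgS g').
  have := base_mul g (g ^+ a) ((p ^+ a) x); rewrite -/p => ->.
  have := base_mul g' (g' ^+ a) ((p ^+ a) x); rewrite -eq_top -/p => ->.
  by rewrite invMg !mulgA.
have E_period a x : E (a + #[p]) x = E a x.
  rewrite /E !expgD (expg_order p) mulg1.
  have := base_mul (g ^+ a) (g ^+ #[p]) x; rewrite topg => ->.
  have := base_mul (g' ^+ a) (g' ^+ #[p]) x; rewrite top' => ->.
  by rewrite -(mulgA _ _ (b x)) eq_b invMg !mulgA mulgK.
have E_mod a x : E (a %% #[p]) x = E a x.
  rewrite {2}(divn_eq a #[p]) addnC; elim: (a %/ _) => [|m IHm] //=.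
    by rewrite mul0n addn0.
  by rewrite mulSnr addnA E_period.
pose h : wreath G n := Wreath [ffun i => E (cycle_time p i) (cycle_root p i)] 1.
suff eq_h : h * g = g' * h.
  by exists h^-1; rewrite conjgE invgK mulgA eq_h mulgK.
apply: wreath_eq; last by rewrite /= mul1g mulg1.
move=> i; rewrite -(permKV p i).
have := base_mul g' h (p^-1 i); rewrite -eq_top -/p => ->.
have := base_mul h g (p (p^-1 i)); rewrite perm1 => ->.
move: (p^-1 i) => {}i; rewrite !ffunE.
(* The time of [p i] is one more than that of [i] only modulo [#[p]], since it drops to 0 when the
   cycle closes; [E_mod] absorbs this. *)
have := rotationsX_inj (n := n) (p := p) (a := cycle_time p (p i))
  (b := (cycle_time p i).+1) (i := cycle_root p i) (top_rotation g).
rewrite -{1}cycle_root_perm cycle_timeK expgSr permM cycle_timeK.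
move=> /(_ erefl) eq_time.
by rewrite -E_mod eq_time E_mod cycle_root_perm E_S cycle_timeK mulgKV.
Qed.

Lemma cycle_class_inj g g' q :
    q \in rotations n -> tp g = tp g' ->
    cycle_class g' =1 permute q (cycle_class g) ->
  g' \in g ^: [set: wreath G n].
Proof.
(* Conjugation by [h] reads the tuple at [tp h i], while [permute q] reads it at [q^-1 i]: hence the
   inverse. *)
move=> Rq eq_top eq_cyc; pose h : wreath G n := Wreath [ffun => 1] (subg _ q^-1).
have tph : tp h = q^-1 by rewrite subgK ?groupV.
have [] := @cycle_class_eq_conj (g ^ h) g'.
- exact/val_inj/(etrans (top_conj g h) eq_top).
- by move=> i; rewrite cycle_class_conj eq_cyc tph.
by move=> h' ->; rewrite -conjgM memJ_class ?inE.
Qed.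

Lemma cycle_class_surj p (t : 'I_n -> {set G}) :
    p \in rotations n -> permute p t = t ->
    (forall i, t i \in classes [set: G]) ->
  exists g, tp g = p /\ cycle_class g = t.
Proof.
move=> Rp tp_inv class_t.
have t_p i : t (p i) = t i by rewrite -{1}tp_inv /permute permK.
(* Each cycle carries one representative, at its base point, and 1 elsewhere, so the cycle product
   is that representative. *)
pose g : wreath G n := Wreath
  [ffun i => if i == cycle_root p i then repr (t i) else 1] (subg _ p).
have tpg : tp g = p by rewrite subgK.
exists g; split => //; apply/funext => i.
have iter_inv (f : 'I_n -> {set G}) a x :
    (forall i, f (p i) = f i) -> f ((p ^+ a) x) = f x.
  by move=> f_p; elim: a => [|a IHa]; rewrite ?perm1 // expgSr permM f_p.
set x := cycle_root p i.
have root_x : cycle_root p x = x.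
  by rewrite /x /cycle_root root_root //; apply: fconnect_sym; apply: perm_inj.
have root_px a : cycle_root p ((p ^+ a) x) = x.
  by elim: a => [|a IHa]; rewrite ?perm1 // expgSr permM cycle_root_perm.
(* The product read along the first [a.+1] points of the cycle meets the base point [x] only once,
   as [a < #[p]]. *)
have base_exp a : a < #[p] -> base (g ^+ a.+1) ((p ^+ a) x) = repr (t x).
  elim: a => [|a IHa] lt_a; first by rewrite expg1 perm1 ffunE root_x eqxx.
  rewrite (expgSr p) permM (expgS g).
  have := base_mul g (g ^+ a.+1) ((p ^+ a) x); rewrite tpg => ->.
  rewrite IHa ?(ltnW lt_a) // ffunE -permM -expgSr root_px.
  case: eqP => [px|_]; last by rewrite mul1g.
  have := rotationsX_inj (a := a.+1) (b := 0) Rp (etrans px (esym (perm1 x))).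
  by rewrite mod0n modn_small.
have cyc_p y : cycle_class g (p y) = cycle_class g y.
  by rewrite -{1}tpg cycle_class_top.
have := base_exp #[p].-1; rewrite prednK ?order_gt0 // => /(_ (leqnn _)) bx.
(* Both tuples are constant on the cycle, so they are compared at its last point, where [bx] gives
   the full product. *)
rewrite -(cycle_timeK p i) !iter_inv // -/x.
rewrite -(iter_inv _ #[p].-1) // /cycle_class tpg bx.
by have /repr_classesP[_ <-] := class_t x.
Qed.

End WreathClasses.

(** * Parametrizing quotients by conjugacy classes *)

Section Classification.
Local Open Scope group_scope.

(** With [q x] as the equivalence class of [x], this says that [cl] induces a bijection from the
    quotient of [A] to the conjugacy classes of [gT]. *)
Definition classifies (X : Type) (A : set X) (q : X -> set X) (gT : finGroupType)
    (cl : X -> {set gT}) : Prop :=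
  [/\ forall x, A x -> cl x \in classes [set: gT],
      forall C, C \in classes [set: gT] -> exists2 x, A x & cl x = C
    & forall x y, A x -> A y -> q x = q y <-> cl x = cl y].

Lemma classifies_set_bij (X Y : Type) (A : set X) (B : set Y) qX qY
    (gT : finGroupType) (clX : X -> {set gT}) (clY : Y -> {set gT}) :
    classifies A qX clX -> classifies B qY clY ->
  exists f : set X -> set Y, set_bij (qX @` A)%classic (qY @` B)%classic f.
Proof.
move=> [inX surjX kerX] [inY surjY kerY].
(* [f] sends a class to the one with the same conjugacy class, and a set that is not a class to the
   default [set0]. *)
have /choice[f fP] (S : set X) : exists T : set Y, forall x, A x -> qX x = S ->
    exists y, [/\ B y, qY y = T & clY y = clX x].
  have [[x [Ax <-]]|noS] := pselect (exists x, A x /\ qX x = S); last first.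
    by exists set0 => x Ax qx; case: noS; exists x.
  have [y By cly] := surjY _ (inX _ Ax).
  exists (qY y) => z Az /kerX-/(_ Az Ax) clz.
  by exists y; split; rewrite // cly.
exists f; split=> [_ [x Ax <-]|S T|_ [y By <-]] /=.
- by have [y [By qy _]] := fP _ x Ax erefl; exists y.
- rewrite !inE => -[x Ax <-] [x' Ax' <-] eq_f.
  have [y [By qy cly]] := fP _ x Ax erefl.
  have [y' [By' qy' cly']] := fP _ x' Ax' erefl.
  by apply/kerX => //; rewrite -cly -cly'; apply/kerY; rewrite // qy qy'.
have [x Ax clx] := surjX _ (inY _ By); exists (qX x); first by exists x.
have [y' [By' qy' cly']] := fP _ x Ax erefl.
by rewrite -qy'; apply/kerY => //; rewrite cly' clx.
Qed.

(** Over an algebraically closed field of characteristic 0 there are as many irreducibles as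
    conjugacy classes. The matching is not canonical: it pairs two enumerations. *)
Lemma irreducible_classifies (R : realType) (gT : finGroupType) :
  exists cl : representation (complex R) gT -> {set gT},
    classifies [set rho | mx_irreducible (tagged rho)]%classic
               (@rep_class (complex R) gT) cl.
Proof.
have charF : [pchar (complex R)]%R^'.-group [set: gT].
  by apply/pgroupP=> p _ _; rewrite inE /= Num.Theory.pchar_num.
have splitF : group_splitting_field (complex R) [set: gT]%G.
  exact: group_closure_closed_field.
pose sG : irrType (complex R) [set: gT] :=
  DecSocleType (regular_repr (complex R) [set: gT]).
have card_sG : #|sG| = #|classes [set: gT]| := card_irr_pchar sG charF splitF.
pose c (i : sG) := enum_val (cast_ord card_sG (enum_rank i)).
have c_inj : injective c.
  by move=> i j /enum_val_inj/cast_ord_inj/enum_rank_inj.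
exists (fun rho => c (irr_comp sG (tagged rho))); split=> [rho _|C class_C|rho rho'].
- exact: enum_valP.
- pose i : sG := enum_val (cast_ord (esym card_sG) (enum_rank_in class_C C)).
  exists (existT _ _ (irr_repr i)) => /=; first exact: socle_irr.
  rewrite (irr_reprK_pchar charF) /c enum_valK cast_ordKV.
  exact: enum_rankK_in.
move=> /= irr irr'; have rsim := rsim_irr_comp_pchar sG charF irr.
have rsim' := rsim_irr_comp_pchar sG charF irr'.
split=> [eq_cls|/c_inj eq_i].
  congr c; apply: (irr_comp_rsim_pchar sG charF).
  suff: rep_class rho rho' by [].
  by rewrite eq_cls; apply: mx_rsim_refl.
have simrr' : mx_rsim (tagged rho) (tagged rho').
  by apply: mx_rsim_trans rsim _; rewrite eq_i; apply: mx_rsim_sym.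
apply/seteqP; split=> rho''; last exact: mx_rsim_trans.
exact/mx_rsim_trans/mx_rsim_sym.
Qed.

Lemma permuteM (T : Type) n (p q : 'S_n) (s : 'I_n -> T) :
  permute p (permute q s) = permute (q * p) s.
Proof. by apply/funext => i; rewrite /permute invMg permM. Qed.

Lemma rotation_stab_permute (T : Type) n (p : 'S_n) (s : 'I_n -> T) :
  p \in rotations n -> rotation_stab (permute p s) = rotation_stab s.
Proof.
move=> Rp; apply/setP => q; rewrite !inE; case Rq: (q \in _) => //=.
apply: asbool_equiv_eq; rewrite permuteM (rotationsC Rp Rq) -permuteM.
split=> [eq_pq|-> //]; apply/funext => i.
by have := congr1 (@^~ (p i)) eq_pq; rewrite /permute /= permK.
Qed.

(** The inductive step, abstracted from labels: [t x] is a tuple of classes of [G], and [l x]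
    numbers a rotation that fixes it. *)
Lemma wreath_classifies (G : finGroupType) n (X : Type) (A : set X)
    (q : X -> set X) (t : X -> 'I_n -> {set G}) (l : X -> nat) :
    (forall x, A x -> forall i, t x i \in classes [set: G]) ->
    (forall x, A x -> 1 <= l x <= #|rotation_stab (t x)|) ->
    (forall s m, (forall i, s i \in classes [set: G]) ->
       1 <= m <= #|rotation_stab s| -> exists x, [/\ A x, t x = s & l x = m]) ->
    (forall x y, A x -> A y -> q x = q y <->
       l x = l y /\ exists2 p, p \in rotations n & t y = permute p (t x)) ->
  exists cl : X -> {set wreath G n}, classifies A q cl.
Proof.
move=> class_t range_l surj_tl ker_tl.
(* Root values start at 1 and [nth] at 0; [ltl] keeps the index in range. *)
pose ptop x := nth 1 (enum (rotation_stab (t x))) (l x).-1.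
have ltl x : A x -> (l x).-1 < size (enum (rotation_stab (t x))).
  by move=> /range_l/andP[l_gt0 lel]; rewrite -cardE prednK.
have /choice[g gP] x : exists g : wreath G n,
    A x -> sgval (top g) = ptop x /\ cycle_class g = t x.
  have [Ax|nAx] := pselect (A x); last by exists 1.
  have := mem_nth 1 (ltl x Ax); rewrite mem_enum inE => /andP[Rp /asboolP tp].
  by have [g gP] := cycle_class_surj Rp tp (class_t x Ax); exists g.
exists (fun x => g x ^: [set: wreath G n]); split=> [x _|C|x y Ax Ay].
- by rewrite mem_classes ?inE.
- case/imsetP=> u _ ->; set s := cycle_class u; set p := sgval (top u).
  have stab_p : p \in rotation_stab s.
    rewrite inE top_rotation; apply/asboolP/funext => i.
    by rewrite /permute /s -[LHS]cycle_class_top permKV.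
  have class_s i : s i \in classes [set: G] by rewrite mem_classes ?inE.
  have lt_p : index p (enum (rotation_stab s)) < #|rotation_stab s|.
    by rewrite cardE index_mem mem_enum.
  have [x [Ax tx lx]] := surj_tl s (index p (enum (rotation_stab s))).+1 class_s lt_p.
  have [gtop gcyc] := gP x Ax.
  exists x => //; apply/class_eqP/(@cycle_class_inj _ _ _ _ 1); rewrite ?group1 //.
    by rewrite gtop /ptop tx lx nth_index // mem_enum.
  by move=> i; rewrite gcyc tx /permute invg1 perm1.
have [gtopx gcycx] := gP x Ax; have [gtopy gcycy] := gP y Ay.
rewrite ker_tl //; split=> [[eq_l [p Rp eq_t]]|].
  apply/esym/class_eqP/(@cycle_class_inj _ _ _ _ p); rewrite ?gcycx ?gcycy ?eq_t //.
  by rewrite gtopx gtopy /ptop eq_l eq_t rotation_stab_permute.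
move=> /esym/class_eqP/imsetP[h _ def_gy].
have eq_t : t y = permute (sgval (top h))^-1 (t x).
  by apply/funext => i; rewrite -gcycy def_gy cycle_class_conj gcycx /permute invgK.
have Rh : (sgval (top h))^-1 \in rotations n by rewrite groupV top_rotation.
split; last by exists (sgval (top h))^-1.
(* Conjugation keeps the top, and rotating a tuple keeps its stabilizer, so both numbers index the
   same duplicate-free list at the same element. *)
have := gtopy; rewrite def_gy top_conj gtopx /ptop eq_t rotation_stab_permute //.
move=> /eqP; rewrite nth_uniq ?enum_uniq ?ltl //; last first.
  by have := ltl y Ay; rewrite eq_t rotation_stab_permute.
have /andP[lx _] := range_l x Ax; have /andP[ly _] := range_l y Ay.
by rewrite -eqSS !prednK // => /eqP.
Qed.

End Classification.

(** * Orbits of compatible labels *)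

Section Labels.
Variable r : nat -> nat.
Local Open Scope group_scope.

Lemma vact_child k (g : W r k.+2) i (x : vertex r k.+1) :
  vact g (Some (i, x) : vertex r k.+2) =
    Some (sgval (top g) i, @vact r k.+1 (base g (sgval (top g) i)) x).
Proof. by []. Qed.

Lemma vact1 k (v : vertex r k) : vact 1 v = v.
Proof.
elim: k v => [|[|k] IHk] // [[i x]|] //.
by rewrite vact_child ffunE IHk perm1.
Qed.

Lemma vactM k (g h : W r k) v : vact (g * h) v = vact g (vact h v).
Proof.
elim: k g h v => [|[|k] IHk] // g h [[i x]|] //; rewrite !vact_child.
have -> : sgval (top (g * h)) i = sgval (top g) (sgval (top h) i).
  by rewrite top_mul (rotationsC (top_rotation g) (top_rotation h)) permM.
by rewrite base_mul IHk.
Qed.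

Lemma label_orbit_eqP k (phi psi : label r k) :
  label_orbit phi = label_orbit psi <-> exists g, psi = lact phi g.
Proof.
split=> [eq_orb|[g ->]].
  suff: label_orbit phi psi by [].
  by rewrite eq_orb; exists 1; apply/funext => v; rewrite /lact vact1.
apply/seteqP; split=> _ [h ->].
  exists (g^-1 * h); apply/funext => v.
  by rewrite /lact -vactM mulKVg.
by exists (g * h); apply/funext => v; rewrite /lact vactM.
Qed.

(** A group element rotates the maximal subtrees and then acts inside each one separately, so an
    orbit amounts to the root value and the tuple of subtree orbits up to rotation. *)
Lemma label_orbit_permuteP k (phi psi : label r k.+2) :
  label_orbit phi = label_orbit psi <->
  phi None = psi None /\ exists2 p, p \in rotations (r k.+2) &
    (fun i => label_orbit (Defs.restrict psi i)) =
      permute p (fun i => label_orbit (Defs.restrict phi i)).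
Proof.
rewrite label_orbit_eqP; split=> [[g ->]|[eq_root [p Rp eq_orb]]].
  split=> //; exists (sgval (top g))^-1; first by rewrite groupV top_rotation.
  apply/funext => i; rewrite /permute invgK; apply/esym/label_orbit_eqP.
  by exists (base g (sgval (top g) i)).
have /fin_all_exists[a aP] i : exists a : W r k.+1,
    Defs.restrict psi i = lact (Defs.restrict phi (p^-1 i)) a.
  by apply/label_orbit_eqP/esym/(congr1 (@^~ i) eq_orb).
(* The base acts at the target index [p^-1 i], so [a i] must be stored there. *)
exists (Wreath [ffun j => a (p j)] (subg _ p^-1)); apply/funext => -[[i x]|] //.
rewrite /lact /= subgK ?groupV // ffunE permKV.
exact: (congr1 (@^~ x) (aP i)).
Qed.

(** The stabilizer depends only on which entries coincide; this passes from tuples of label orbits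
    to tuples of conjugacy classes. *)
Lemma eq_rotation_stab (S T : Type) n (s : 'I_n -> S) (t : 'I_n -> T) :
    (forall i j, s i = s j <-> t i = t j) -> rotation_stab s = rotation_stab t.
Proof.
move=> eq_st; apply/setP => p; rewrite !inE; congr (_ && _).
by apply: asbool_equiv_eq; split=> /(congr1 (@^~ _)) eq_p;
  apply/funext => i; apply/eq_st/eq_p.
Qed.

Lemma compatible_classifies : (forall i, 0 < i -> 0 < r i) ->
  forall k, exists cl : label r k.+1 -> {set W r k.+1},
    classifies (@compatible r k.+1) (@label_orbit r k.+1) cl.
Proof.
move=> r_pos; elim=> [|k [cl [class_cl surj_cl ker_cl]]].
  (* The trivial group has a single class, so [e] is the only tuple and all [r 1] rotations fix
     it. *)
  pose e : 'I_(r 1) -> {set W r 0} := fun=> 1 ^: [set: W r 0].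
  have card_e : #|rotation_stab e| = r 1.
    rewrite -[RHS]card_rotations ?r_pos //; apply: eq_card => p.
    by rewrite inE [X in _ && X]asboolT ?andbT.
  apply: (@wreath_classifies (W r 0) (r 1) _ _ _ (fun=> e) (fun phi => phi tt)).
  - by move=> phi _ i; rewrite mem_classes ?inE.
  - by move=> phi; rewrite card_e.
  - move=> s m class_s; have -> : s = e.
      apply/funext => i; have /imsetP[x _ ->] := class_s i.
      by rewrite (ord1 x) [X in _ = X ^: _]ord1.
    by rewrite card_e => le_m; exists (fun=> m).
  move=> phi psi _ _; apply: (iff_trans (@label_orbit_eqP 1 phi psi)); split=> [[g ->]|[eq_root _]].
    by split=> //; exists 1; rewrite ?group1 //; apply/funext.
  by exists 1; apply/funext => -[].
pose t (phi : label r k.+2) i := cl (Defs.restrict phi i).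
have stab_t phi : (forall i, compatible (Defs.restrict phi i)) ->
    rotation_stab (fun i => label_orbit (Defs.restrict phi i)) = rotation_stab (t phi).
  move=> comp_phi; apply: eq_rotation_stab => i j.
  exact: ker_cl (comp_phi i) (comp_phi j).
apply: (@wreath_classifies (W r k.+1) _ _ _ _ t (fun phi => phi None)).
- by move=> phi [comp_phi _] i; apply: class_cl (comp_phi i).
- by move=> phi [comp_phi]; rewrite stab_t.
- move=> s m class_s le_m.
  have /choice[psi psiP] i : exists psi, compatible psi /\ cl psi = s i.
    by have [psi] := surj_cl _ (class_s i); exists psi.
  pose phi : label r k.+2 := fun v => if v is Some (i, x) then psi i x else m.
  have comp_phi i : compatible (Defs.restrict phi i) := (psiP i).1.
  have t_phi : t phi = s by apply/funext => i; apply: (psiP i).2.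
  by exists phi; split=> //; split; rewrite // stab_t // t_phi.
move=> phi psi [comp_phi _] [comp_psi _]; apply: (iff_trans (@label_orbit_permuteP k phi psi)).
have ker i j : label_orbit (Defs.restrict psi i) = label_orbit (Defs.restrict phi j)
    <-> t psi i = t phi j := ker_cl _ _ (comp_psi i) (comp_phi j).
split=> -[-> [p Rp eq_p]]; split=> //; exists p => //; apply/funext => i.
  by apply/(ker i (p^-1 i)); have := congr1 (@^~ i) eq_p.
by apply/(ker i (p^-1 i)); have := congr1 (@^~ i) eq_p.
Qed.

End Labels.

Theorem proposition1 (R : realType) (r : nat -> nat)
  (r_pos : forall i : nat, (0 < i)%N -> (0 < r i)%N)
  (k : nat) (k_pos : (1 <= k)%N) :
  exists f : set (representation (complex R) (W r k)) -> set (label r k),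
    set_bij (irreducible_classes (complex R) (W r k)) (compatible_orbits r k) f.
Proof.
case: k k_pos => // k _.
have [clR clRP] := irreducible_classifies R (W r k.+1).
have [clL clLP] := compatible_classifies r_pos k.
exact: classifies_set_bij clRP clLP.
Qed.
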